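(* Let $P$ be a simple planar polygon (vertices in general position), and suppose the pairwise noncrossing diagonals $\mathcal{D}=\{d_1,\ldots,d_k\}$ of $P$ divide $P$ into polygons $Q_0,\ldots,Q_k$. Then $\mathcal{K}_P(\mathcal{D})$ is isomorphic to the cartesian product $\mathcal{K}_{Q_0}\times\cdots\times\mathcal{K}_{Q_k}$.
   Context: A diagonal of a polygon is a line segment connecting two of its vertices contained in its interior. A convex diagonalization of a polygon $R$ is a partition of $R$ into convex polygons by pairwise noncrossing diagonals; $\pi(R)$ is the poset of these with $a\prec a'$ if $a$ is obtained from $a'$ by adding diagonals. For a simple polygon $R$, $\mathcal{K}_R$ is a polytopal complex whose face poset is isomorphic to $\pi(R)$ (the subcomplex of the associahedron $\mathcal{K}_m$, $m$ the number of vertices of $R$, consisting of faces corresponding to convex diagonalizations of $R$). $\mathcal{K}_P(\mathcal{D})$ denotes the collection of faces of $\mathcal{K}_P$ corresponding to convex diagonalizations of $P$ that contain $\mathcal{D}$. *)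

(* Defs.v *)
From HB Require Import structures.
From mathcomp Require Import all_boot all_order all_algebra.
From mathcomp Require Import all_classical all_reals all_analysis.

Set Implicit Arguments.
Unset Strict Implicit.
Unset Printing Implicit Defensive.

Import Order.TTheory GRing.Theory Num.Theory.
Import numFieldNormedType.Exports.

Local Open Scope classical_set_scope.
Local Open Scope ring_scope.

Section Polygons.
Variable R : realType.
Local Notation plane := 'rV[R]_2.

Definition segment (a b : plane) : set plane :=
  [set (1 - t) *: a + t *: b | t in `[0, 1]].

Definition open_segment (a b : plane) : set plane :=
  [set (1 - t) *: a + t *: b | t in `]0, 1[].

Definition collinear (a b c : plane) : Prop :=
  (b 0 0 - a 0 0) * (c 0 1 - a 0 1) = (c 0 0 - a 0 0) * (b 0 1 - a 0 1).

(* A polygon with n vertices is given by its cyclic sequence of vertices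
   p : 'I_n -> plane; the cyclic successor of an index is ordS. *)

Definition edge n (p : 'I_n -> plane) (i : 'I_n) : set plane :=
  segment (p i) (p (ordS i)).

Definition simple_polygon n (p : 'I_n -> plane) : Prop :=
  [/\ (3 <= n)%N, injective p &
      forall i j, i != j -> edge p i `&` edge p j `<=`
        [set p i; p (ordS i)] `&` [set p j; p (ordS j)]].

Definition general_position n (p : 'I_n -> plane) : Prop :=
  forall i j k, i != j -> j != k -> i != k -> ~ collinear (p i) (p j) (p k).

Definition boundary n (p : 'I_n -> plane) : set plane :=
  \bigcup_(i in [set: 'I_n]) edge p i.

(* The bounded part of the complement of the boundary curve. *)
Definition polygon_interior n (p : 'I_n -> plane) : set plane :=
  [set x | (~` boundary p) x /\
           bounded_set (connected_component (~` boundary p) x)].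

(* A diagonal is a segment of the plane, rather than a pair of indices, so that
   diagonals of a polygon and of its pieces can be compared directly. *)
Definition diagonal n (p : 'I_n -> plane) (d : set plane) : Prop :=
  exists i j, d = segment (p i) (p j) /\
    open_segment (p i) (p j) `<=` polygon_interior p.

Definition noncrossing n (p : 'I_n -> plane) (d d' : set plane) : Prop :=
  d `&` d' `<=` range p.

Definition noncrossing_diagonals n (p : 'I_n -> plane) (D : set (set plane)) :
    Prop :=
  (forall d, D d -> diagonal p d) /\
  (forall d d', D d -> D d' -> d <> d' -> noncrossing p d d').

(* The interiors of the polygons into which the diagonals in D cut p. *)
Definition pieces n (p : 'I_n -> plane) (D : set (set plane)) :
    set (set plane) :=
  let U := polygon_interior p `\` \bigcup_(d in D) d in
  [set connected_component U x | x in U].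

(* The polygon with interior C is the closure of C. *)
Definition convex_diagonalization n (p : 'I_n -> plane) (a : set (set plane)) :
    Prop :=
  noncrossing_diagonals p a /\
  (forall C, pieces p a C -> convex_set (closure C)).

Definition divides n (p : 'I_n -> plane) (D : set (set plane))
    k (m : 'I_k -> nat) (Q : forall i, 'I_(m i) -> plane) : Prop :=
  [/\ forall i, simple_polygon (Q i),
      forall i j, range p (Q i j),
      forall i j, range (edge p) (edge (Q i) j) \/ D (edge (Q i) j) &
      set_bij [set: 'I_k] (pieces p D) (fun i => polygon_interior (Q i))].

End Polygons.

Section Complexes.
Variable R : realType.

(* Polytopes and faces are nonempty: the face posets considered here do not
   contain the empty face. *)

Definition polytope N (X : set 'rV[R]_N) : Prop :=
  exists n (v : 'I_n.+1 -> 'rV[R]_N),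
    X = [set x | exists l : 'I_n.+1 -> R,
           [/\ forall j, 0 <= l j, \sum_j l j = 1 & x = \sum_j l j *: v j]].

Definition face N (X F : set 'rV[R]_N) : Prop :=
  F !=set0 /\
  exists (c : 'rV[R]_N) (b : R),
    (forall x, X x -> \sum_i c 0 i * x 0 i <= b) /\
    F = X `&` [set x | \sum_i c 0 i * x 0 i = b].

Definition polytopal_complex N (K : set (set 'rV[R]_N)) : Prop :=
  [/\ finite_set K,
      forall X, K X -> polytope X,
      forall X F, K X -> face X F -> K F &
      forall X Y, K X -> K Y -> X `&` Y !=set0 ->
        face X (X `&` Y) /\ face Y (X `&` Y)].

(* K is a polytopal complex whose face poset is identified by lab with the
   poset of convex diagonalizations of p, in which adding diagonals goes down. *)
Definition diagonalization_complex n (p : 'I_n -> 'rV[R]_2) N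
    (K : set (set 'rV[R]_N)) (lab : set 'rV[R]_N -> set (set 'rV[R]_2)) : Prop :=
  [/\ polytopal_complex K,
      set_bij K [set a | convex_diagonalization p a] lab &
      forall F G, K F -> K G -> (F `<=` G <-> lab G `<=` lab F)].

Definition faces_containing N (K : set (set 'rV[R]_N))
    (lab : set 'rV[R]_N -> set (set 'rV[R]_2)) (D : set (set 'rV[R]_2)) :
    set (set 'rV[R]_N) :=
  [set F | K F /\ D `<=` lab F].

Definition product_complex k (N : 'I_k -> nat)
    (K : forall i, set (set 'rV[R]_(N i))) :
    set (set (forall i, 'rV[R]_(N i))) :=
  [set X | exists F : forall i, set 'rV[R]_(N i),
     (forall i, K i (F i)) /\ X = [set x | forall i, F i (x i)]].

Definition isomorphic_complexes (T U : Type) (K : set (set T))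
    (L : set (set U)) : Prop :=
  exists f : set T -> set U, set_bij K L f /\
    forall F G, K F -> K G -> (F `<=` G <-> f F `<=` f G).

End Complexes.

(* Main.v *)
(** A convex diagonalization [b] of [p] containing [D] is cut into the families
    [b_i] of its members that are diagonals of [Q i], and is recovered as the
    union of [D] and the [b_i].  The open part of a diagonal in [b \ D] is
    connected and avoids [D], so it lies in the interior of a single [Q i]; its
    endpoints are vertices of [p] that are not interior to [Q i], hence they lie
    on the boundary of [Q i], and are then vertices of [Q i].  The connected
    components left by the union of [D] and the [b_i] are exactly those left by
    each [b_i] in [Q i], so convexity can be tested piece by piece.  The order on
    boxes is the product order because faces are nonempty. *)

From mathcomp Require Import lra.
From mathcomp Require Import all_boot all_order all_algebra.
From mathcomp Require Import all_classical all_reals all_analysis.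
Require Import Defs.

Import Order.TTheory GRing.Theory Num.Theory.
Import numFieldNormedType.Exports.

Local Open Scope classical_set_scope.
Local Open Scope ring_scope.

(** * Segments of the plane and their endpoints *)

Section Segments.
Context {R : realType}.
Implicit Types a b x y z w : 'rV[R]_2.

(** A continuous image of an interval. The interval is left arbitrary because both open and
    half-open segments are needed. *)
Lemma connected_segment_part a b (i : interval R) :
  connected [set (1 - t) *: a + t *: b | t in [set` i]].
Proof.
apply: connected_continuous_connected.
  exact/connected_intervalP/interval_is_interval.
apply: continuous_subspaceT => t.
apply: cvgD.
  apply: cvgZr_tmp; apply: cvgB; [exact: cvg_cst|exact: cvg_id].
by apply: cvgZr_tmp; exact: cvg_id.
Qed.

Lemma open_segment_sub_segment a b : open_segment a b `<=` segment a b.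
Proof.
by move=> x [t /=]; rewrite in_itv/= => /andP[t0 t1] <-; exists t => //=;
  rewrite in_itv/= (ltW t0) (ltW t1).
Qed.

Lemma segment_left a b : segment a b a.
Proof.
by exists 0 => /=; rewrite ?in_itv/= ?lexx ?ler01// subr0 scale1r scale0r addr0.
Qed.

Lemma segment_right a b : segment a b b.
Proof.
by exists 1 => /=; rewrite ?in_itv/= ?lexx ?ler01// subrr scale1r scale0r add0r.
Qed.

Lemma segmentC a b : segment a b = segment b a.
Proof.
rewrite eqEsubset; split=> x [t /=]; rewrite in_itv/= => /andP[t0 t1] <-;
  (exists (1 - t); first by rewrite /= in_itv/=; lra);
  by rewrite opprB addrCA subrr addr0 addrC.
Qed.

Lemma open_segmentC a b : open_segment a b = open_segment b a.
Proof.
rewrite eqEsubset; split=> x [t /=]; rewrite in_itv/= => /andP[t0 t1] <-;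
  (exists (1 - t); first by rewrite /= in_itv/=; lra);
  by rewrite opprB addrCA subrr addr0 addrC.
Qed.

Lemma open_segment_nonempty a b : open_segment a b !=set0.
Proof.
by exists ((1 - 2^-1) *: a + 2^-1 *: b); exists 2^-1 => //=; rewrite in_itv/=; lra.
Qed.

Lemma segmentP a b x :
  segment a b x -> [\/ x = a, x = b | open_segment a b x].
Proof.
case=> t /=; rewrite in_itv/= => /andP[t0 t1] <-.
have [->|tN0] := eqVneq t 0.
  by apply: Or31; rewrite subr0 scale1r scale0r addr0.
have [->|tN1] := eqVneq t 1.
  by apply: Or32; rewrite subrr scale1r scale0r add0r.
by apply: Or33; exists t => //=; rewrite in_itv/= !lt_neqAle eq_sym tN0 tN1 t0.
Qed.

(** An endpoint is an extreme point. If [z] lay strictly between [x] and [y], with parameters [s]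
    and [u] of these on the segment from [z] to [w], then [((1 - t) * s + t * u) *: (w - z) = 0];
    both summands are nonnegative, so [s = 0] or [w = z], and in either case [x = z]. *)
Lemma segment_eq_left x y z w : segment x y = segment z w -> z = x \/ z = y.
Proof.
move=> E; have zxy : segment x y z by rewrite E; exact: segment_left.
have [->|->|] := segmentP _ _ _ zxy; [by left|by right|].
case=> t /=; rewrite in_itv/= => /andP[t0 t1] zE; left.
have [s /=] : segment z w x by rewrite -E; exact: segment_left.
rewrite in_itv/= => /andP[s0 s1] xE.
have [u /=] : segment z w y by rewrite -E; exact: segment_right.
rewrite in_itv/= => /andP[u0 u1] yE.
have : ((1 - t) * s + t * u) *: (w - z) = 0.
  apply/rowP => j; have := congr1 (fun v : 'rV_2 => v 0 j) zE.
  by rewrite -xE -yE !mxE => H; lra.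
move/eqP; rewrite scaler_eq0 => /orP[/eqP c0|].
  have s_0 : s = 0.
    have := mulr_ge0 (ltW t0) u0.
    have : 0 <= (1 - t) * s by rewrite mulr_ge0// subr_ge0 ltW.
    move=> h1 h2; have /eqP : (1 - t) * s = 0 by lra.
    by rewrite mulf_eq0 => /orP[/eqP|/eqP//]; lra.
  by rewrite -xE s_0 subr0 scale1r scale0r addr0.
by rewrite subr_eq0 => /eqP wz; rewrite -xE wz -scalerDl subrK scale1r.
Qed.

Lemma segment_eq_ends x y z w v : segment x y = segment z w ->
  v = z \/ v = w -> v = x \/ v = y.
Proof.
move=> E [->|->]; first exact: segment_eq_left E.
by apply: segment_eq_left; rewrite E segmentC.
Qed.

End Segments.

(** * Vertices, diagonals and interior of a single polygon *)

Section Polygon.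
Context {R : realType} {n : nat} (p : 'I_n -> 'rV[R]_2).

Lemma vertex_boundary i : boundary p (p i).
Proof. by exists i => //; exact: segment_left. Qed.

Lemma vertex_notin_interior i : ~ polygon_interior p (p i).
Proof. by case=> + _; apply; exact: vertex_boundary. Qed.

Lemma polygon_interior_connected (A : set 'rV[R]_2) x y : connected A ->
  A `<=` ~` boundary p -> A x -> A y ->
  polygon_interior p x -> polygon_interior p y.
Proof.
move=> Ac AB Ax Ay [_ bx]; split; first exact: AB.
by rewrite -(same_connected_component (connected_component_max Ax AB Ac Ay)).
Qed.

(** [p j] also lies on the edge that starts there, and distinct edges meet only in common
    endpoints. *)
Lemma edge_vertex i j : simple_polygon p -> edge p i (p j) ->
  p j = p i \/ p j = p (ordS i).
Proof.
case=> _ _ eI ij; have [->|neq] := eqVneq i j; first by left.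
have [] // : ([set p i; p (ordS i)] `&` [set p j; p (ordS j)]) (p j).
by apply: eI => //; split=> //; exact: segment_left.
Qed.

Lemma diagonal_vertex i j l :
  open_segment (p i) (p j) `<=` polygon_interior p ->
  segment (p i) (p j) (p l) -> p l = p i \/ p l = p j.
Proof.
move=> dI /segmentP[->|->|/dI]; [by left|by right|].
by move/vertex_notin_interior.
Qed.

Lemma diagonal_subset (e : set 'rV[R]_2) : diagonal p e ->
  e `<=` polygon_interior p `|` range p.
Proof.
by case=> i [j [-> eI]] x /segmentP[->|->|/eI];
  [right; exists i|right; exists j|left].
Qed.

End Polygon.

(** The inverse of restricting a diagonalization that contains [D] to the pieces. *)
Definition glue {R : realType} {k : nat} (D : set (set 'rV[R]_2))
    (a : 'I_k -> set (set 'rV[R]_2)) : set (set 'rV[R]_2) :=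
  D `|` \bigcup_(i in [set: 'I_k]) a i.

(** * The pieces cut out by [D] and their diagonals *)

Section Division.
Context {R : realType} {n : nat} {p : 'I_n -> 'rV[R]_2}.
Context {D : set (set 'rV[R]_2)} {k : nat} {m : 'I_k -> nat}.
Context {Q : forall i, 'I_(m i) -> 'rV[R]_2}.
Hypothesis p_simple : simple_polygon p.
Hypothesis D_noncrossing : noncrossing_diagonals p D.
Hypothesis D_divides : divides p D Q.

Let U := polygon_interior p `\` \bigcup_(d in D) d.

(** By [divides], the interior of [Q i] is the component of some point of [U], and any of its points
    determines that component. *)
Lemma component_piece i x :
  polygon_interior (Q i) x -> connected_component U x = polygon_interior (Q i).
Proof.
case: D_divides => _ _ _ [/(_ i I)/= + _ _] => -[y _ <-].
by move/same_connected_component ->.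
Qed.

Lemma piece_subset i : polygon_interior (Q i) `<=` U.
Proof.
by move=> x ix; have := ix; rewrite -(component_piece _ _ ix);
  exact: connected_component_sub.
Qed.

Lemma piece_cover x : U x -> exists i, polygon_interior (Q i) x.
Proof.
move=> Ux; case: D_divides => _ _ _ [_ _ /(_ (connected_component U x))].
case=> [|i _ /= iE]; first by exists x.
by exists i; rewrite iE; exact: connected_component_refl.
Qed.

Lemma piece_disjoint i j x :
  polygon_interior (Q i) x -> polygon_interior (Q j) x -> i = j.
Proof.
move=> ix jx; case: D_divides => _ _ _ [_ injQ _].
by apply: injQ; rewrite ?in_setE//= -(component_piece _ _ ix) (component_piece _ _ jx).
Qed.

Lemma piece_vertex_notin_interior i j : ~ polygon_interior p (Q i j).
Proof.
case: D_divides => _ /(_ i j)[l _ <-] _ _; exact: vertex_notin_interior.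
Qed.

Lemma piece_diagonal i e : diagonal (Q i) e -> diagonal p e.
Proof.
case=> a [b [-> eI]]; case: D_divides => _ Qp _ _.
have [a' _ a'E] := Qp i a; have [b' _ b'E] := Qp i b.
by exists a', b'; rewrite a'E b'E; split=> // x /eI /piece_subset[].
Qed.

Lemma piece_diagonal_notin i e : diagonal (Q i) e -> ~ D e.
Proof.
case=> a [b [-> eI]] De.
have [x ex] := open_segment_nonempty (Q i a) (Q i b).
have [_] := piece_subset _ _ (eI _ ex); apply; exists (segment (Q i a) (Q i b)) => //.
exact: open_segment_sub_segment.
Qed.

(** A point of the open diagonal is interior to [Q i], so it is not a vertex of [Q j]; hence it is
    interior to [Q j] too, and the pieces are disjoint. *)
Lemma piece_diagonal_inj i j e : diagonal (Q i) e -> diagonal (Q j) e -> i = j.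
Proof.
move=> [a [b [-> eI]]] dj.
have [x ex] := open_segment_nonempty (Q i a) (Q i b).
have [jx|[l _ lE]] := diagonal_subset _ _ dj _ (open_segment_sub_segment _ _ _ ex).
  exact: piece_disjoint (eI _ ex) jx.
have [] := piece_subset _ _ (eI _ ex).
by rewrite -lE => /piece_vertex_notin_interior.
Qed.

(** An edge of [Q i] is, as a set, an edge of [p] or a diagonal in [D]. Both contain no vertices of
    [p] besides their endpoints, and equal segments have equal endpoints. *)
Lemma vertex_on_piece_boundary i l : boundary (Q i) (p l) -> range (Q i) (p l).
Proof.
case=> j _ jl; suff [->|->] : p l = Q i j \/ p l = Q i (ordS j).
- by exists j.
- by exists (ordS j).
case: D_divides => _ _ /(_ i j)[[h _ hE]|/(D_noncrossing.1)[a [b [E dI]]]] _.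
  apply: (segment_eq_ends _ _ _ _ _ (esym hE)).
  by apply: edge_vertex => //; rewrite hE.
apply: (segment_eq_ends _ _ _ _ _ E).
by apply: diagonal_vertex => //; rewrite -E.
Qed.

(* If [p l] were off the boundary of [Q i], the half-open segment from [p l]
   would put it in the interior of [Q i], hence in that of [p]. *)
Lemma open_segment_piece_vertex i l b :
  open_segment (p l) b `<=` polygon_interior (Q i) -> range (Q i) (p l).
Proof.
move=> eI; apply: vertex_on_piece_boundary; apply: contrapT => lN.
have [x ex] := open_segment_nonempty (p l) b.
suff : polygon_interior (Q i) (p l).
  by move/piece_subset => -[+ _]; exact: vertex_notin_interior.
apply: (polygon_interior_connected _ _ x _
  (connected_segment_part (p l) b `[0, 1[)) (eI _ ex).
- move=> y [t /=]; rewrite in_itv/= => /andP[t0 t1] <-.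
  have [->|tN0] := eqVneq t 0.
    by rewrite subr0 scale1r scale0r addr0.
  apply: (eI _ _).1; exists t => //=.
  by rewrite in_itv/= lt_neqAle eq_sym tN0 t0.
- case: ex => t /=; rewrite in_itv/= => /andP[t0 t1] <-; exists t => //=.
  by rewrite in_itv/= (ltW t0).
- by exists 0 => /=; rewrite ?in_itv/= ?lexx ?ltr01// subr0 scale1r scale0r addr0.
Qed.

Lemma diagonal_in_piece e : diagonal p e ->
  (forall d, D d -> noncrossing p e d) -> exists i, diagonal (Q i) e.
Proof.
case=> a [b [-> eI]] eD.
have eU : open_segment (p a) (p b) `<=` U.
  move=> x ex; split; first exact: eI.
  (* A common point with a member of [D] would be a vertex of [p], yet it is interior to [p]. *)
  case=> d Dd dx; have [] := eD d Dd x.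
    by split=> //; exact: open_segment_sub_segment.
  by move=> l _ lE; apply: (vertex_notin_interior p l); rewrite lE; exact: eI.
have [x ex] := open_segment_nonempty (p a) (p b).
have [i ix] := piece_cover _ (eU _ ex).
have ei : open_segment (p a) (p b) `<=` polygon_interior (Q i).
  rewrite -(component_piece _ _ ix); apply: connected_component_max => //.
  exact: connected_segment_part.
exists i.
have [a' _ a'E] := open_segment_piece_vertex _ _ _ ei.
have [b' _ b'E] : range (Q i) (p b).
  by apply: (open_segment_piece_vertex _ _ (p a)); rewrite open_segmentC.
by exists a', b'; rewrite a'E b'E.
Qed.

(** * Gluing families of diagonals of the pieces *)

Section Union.
Variable a : 'I_k -> set (set 'rV[R]_2).
Hypothesis a_diagonal : forall i e, a i e -> diagonal (Q i) e.

Lemma glue_diagonal i : glue D a `&` diagonal (Q i) = a i.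
Proof.
rewrite eqEsubset; split=> e.
  case=> -[De|[j _ je]] ie; first by have := piece_diagonal_notin _ _ ie De.
  by rewrite (piece_diagonal_inj _ _ _ ie (a_diagonal _ _ je)).
by move=> ie; split; [right; exists i|exact: a_diagonal].
Qed.

(** Inside [Q i] only [a i] removes points: [D] avoids the interior of [Q i], and so do the
    diagonals of the other pieces, which consist of points interior to those pieces and of
    vertices. *)
Lemma glue_complement i x : polygon_interior (Q i) x ->
  (polygon_interior p `\` \bigcup_(e in glue D a) e) x <->
  (polygon_interior (Q i) `\` \bigcup_(e in a i) e) x.
Proof.
move=> ix; have [px Dx] := piece_subset _ _ ix; split=> -[_ gx]; split=> //.
  by case=> e ie ex; apply: gx; exists e => //; right; exists i.
case=> e [De|[j _ je]] ex; first by apply: Dx; exists e.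
have [jx|[l _ lE]] := diagonal_subset _ _ (a_diagonal _ _ je) _ ex.
  by apply: gx; exists e => //; rewrite (piece_disjoint _ _ _ ix jx).
by move: px; rewrite -lE => /piece_vertex_notin_interior.
Qed.

(** The component in [V] is connected inside [U], so it stays in [Q i], where [V] and [W] agree;
    maximality of components then gives both inclusions. *)
Lemma glue_component i x : polygon_interior (Q i) x ->
  (polygon_interior p `\` \bigcup_(e in glue D a) e) x ->
  connected_component (polygon_interior p `\` \bigcup_(e in glue D a) e) x =
  connected_component (polygon_interior (Q i) `\` \bigcup_(e in a i) e) x.
Proof.
move=> ix; set V := _ `\` _ => Vx; set W := _ `\` _.
have WV : W `<=` V by move=> y Wy; apply/(glue_complement i y Wy.1).
have VU : V `<=` U.
  move=> y [py gy]; split=> // -[d Dd dy]; apply: gy; exists d => //; by left.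
have CQ : connected_component V x `<=` polygon_interior (Q i).
  rewrite -(component_piece _ _ ix); apply: connected_component_max.
  - exact: connected_component_refl.
  - exact: subset_trans (@connected_component_sub _ _ _) VU.
  - exact: component_connected.
have Wx : W x by apply/(glue_complement i x ix).
rewrite eqEsubset; split; apply: connected_component_max.
- exact: connected_component_refl.
- move=> y Cy; apply/(glue_complement i y (CQ _ Cy)).
  exact: connected_component_sub Cy.
- exact: component_connected.
- exact: connected_component_refl.
- exact: subset_trans (@connected_component_sub _ _ _) WV.
- exact: component_connected.
Qed.

Lemma pieces_glue : pieces p (glue D a) = \bigcup_(i in [set: 'I_k]) pieces (Q i) (a i).
Proof.
rewrite eqEsubset; split=> C.
  case=> x Vx <-; have [|i ix] := piece_cover x.
    by case: Vx => px gx; split=> // -[d Dd dx]; apply: gx; exists d => //; left.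
  exists i => //; exists x; first exact/(glue_complement i x ix).
  by rewrite (glue_component i).
case=> i _ [x Wx <-].
have Vx := (glue_complement i x Wx.1).2 Wx.
by exists x => //; rewrite (glue_component i x Wx.1).
Qed.

(** A point of a diagonal of [Q i] is a vertex of [Q i] or interior to it. Interior points are
    neither vertices of [p], nor on [D], nor interior to another piece, so crossings can occur only
    within one [a i]. *)
Lemma noncrossing_glue : noncrossing_diagonals p (glue D a) <->
  forall i, noncrossing_diagonals (Q i) (a i).
Proof.
case: D_divides => _ Qp _ _; split=> [[_ gN] i|aN].
  split=> [e|e e' ie ie' ee' x [ex e'x]]; first exact: a_diagonal.
  have [ix|//] := diagonal_subset _ _ (a_diagonal _ _ ie) _ ex.
  have [||l _ lE] := gN e e' _ _ ee' x (conj ex e'x); [by right; exists i..|].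
  by have [] := piece_subset _ _ ix; rewrite -lE => /vertex_notin_interior.
have DQ i e d : a i e -> D d -> noncrossing p e d.
  move=> ie Dd x [ex dx].
  have [ix|[l _ <-//]] := diagonal_subset _ _ (a_diagonal _ _ ie) _ ex.
  by have [_] := piece_subset _ _ ix; case; exists d.
split=> [e [/D_noncrossing.1//|[i _ ie]]|].
  by apply: (piece_diagonal i); exact: a_diagonal.
move=> e e' [De|[i _ ie]] [De'|[j _ je']] ee'.
- exact: D_noncrossing.2.
- by move=> x [ex e'x]; exact: (DQ j e' e).
- exact: (DQ i).
- move=> x [ex e'x].
  have [ix|[l _ <-//]] := diagonal_subset _ _ (a_diagonal _ _ ie) _ ex.
  have [jx|[l _ <-//]] := diagonal_subset _ _ (a_diagonal _ _ je') _ e'x.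
  have ij := piece_disjoint _ _ _ ix jx; subst j.
  by have [l _ <-] := (aN i).2 e e' ie je' ee' x (conj ex e'x).
Qed.

Lemma convex_glue : convex_diagonalization p (glue D a) <->
  forall i, convex_diagonalization (Q i) (a i).
Proof.
rewrite /convex_diagonalization pieces_glue; split=> [[gN gC] i|aN].
  split; first by move/noncrossing_glue: gN.
  by move=> C iC; apply: gC; exists i.
split; first by apply/noncrossing_glue => i; have [] := aN i.
by move=> C [i _ iC]; apply: (aN i).2.
Qed.

End Union.

Lemma glue_restrict b : noncrossing_diagonals p b -> D `<=` b ->
  glue D (fun i => b `&` diagonal (Q i)) = b.
Proof.
move=> [bD bN] Db; rewrite eqEsubset; split=> e.
  by case=> [/Db//|[i _ []]].
move=> be; have [De|De] := pselect (D e); first by left.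
have [d Dd|i ie] := diagonal_in_piece e (bD e be); last by right; exists i.
by apply: bN => //; [exact: Db|move=> ed; apply: De; rewrite ed].
Qed.

End Division.

(** * Boxes of faces and the isomorphism of complexes *)

Lemma polytope_nonempty (R : realType) N (X : set 'rV[R]_N) :
  polytope X -> X !=set0.
Proof.
case=> n [v ->]; exists (v ord0); exists (fun j => (j == ord0)%:R); split.
- by move=> j; rewrite ler0n.
- by rewrite (bigD1 ord0)//= big1 ?addr0// => j /negPf ->.
- rewrite (bigD1 ord0)//= scale1r big1 ?addr0// => j /negPf ->.
  by rewrite scale0r.
Qed.

Lemma box_subset k (T : 'I_k -> Type) (F G : forall i, set (T i)) :
  (forall i, F i !=set0) ->
  ([set x | forall i, F i (x i)] `<=` [set x | forall i, G i (x i)]) <->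
  (forall i, F i `<=` G i).
Proof.
move=> F0; split=> [FG i y Fy|FG x Fx i]; last exact: FG.
(* Extends [y] to a point of the box. As [T j] depends on [j], having coordinate [y] at [i] is
   expressed by transport along [i = j]. *)
have x j : {z : T j | F j z /\ forall e : i = j, z = eq_rect i T y j e}.
  apply: cid; have [ij|ij] := pselect (i = j).
    subst j; exists y; split=> // e.
    by rewrite (eq_irrelevance e erefl).
  by have [z Fz] := F0 j; exists z.
have /(_ i) := FG (fun j => sval (x j)) (fun j => (svalP (x j)).1).
by rewrite (svalP (x i)).2.
Qed.

Theorem theorem2p3 (R : realType)
    (n : nat) (p : 'I_n -> 'rV[R]_2)
    (k : nat) (d : 'I_k -> set 'rV[R]_2)
    (m : 'I_k.+1 -> nat) (Q : forall i : 'I_k.+1, 'I_(m i) -> 'rV[R]_2)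
    (NP : nat) (KP : set (set 'rV[R]_NP))
    (labP : set 'rV[R]_NP -> set (set 'rV[R]_2))
    (N : 'I_k.+1 -> nat) (K : forall i : 'I_k.+1, set (set 'rV[R]_(N i)))
    (lab : forall i : 'I_k.+1, set 'rV[R]_(N i) -> set (set 'rV[R]_2))
    (p_simple : simple_polygon p) (p_general : general_position p)
    (d_inj : injective d) (d_noncrossing : noncrossing_diagonals p (range d))
    (d_divides : divides p (range d) Q)
    (KP_complex : diagonalization_complex p KP labP)
    (K_complex : forall i : 'I_k.+1, diagonalization_complex (Q i) (K i) (lab i)) :
  isomorphic_complexes (faces_containing KP labP (range d)) (product_complex K).
Proof.
have [_ [labP_conv labP_inj labP_surj] labP_le] := KP_complex.
have K0 i G : K i G -> G !=set0.
  have [[_ Kpoly _ _] _ _] := K_complex i.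
  by move/Kpoly; exact: polytope_nonempty.
have labK i G : K i G -> convex_diagonalization (Q i) (lab i G).
  by have [_ [+ _ _] _] := K_complex i; apply.
have lab_le i F G : K i F -> K i G -> (F `<=` G <-> lab i G `<=` lab i F).
  by have [_ _ +] := K_complex i; apply.
pose res F i := labP F `&` diagonal (Q i).
have res_conv F : faces_containing KP labP (range d) F ->
    forall i, convex_diagonalization (Q i) (res F i).
  move=> [KF dF]; apply/(convex_glue d_noncrossing d_divides (res F)).
    by move=> i e [].
  have cF := labP_conv F KF.
  by rewrite (glue_restrict p_simple d_noncrossing d_divides)//; case: cF.
(* The face of [K i] labelled by the restriction of [labP F]; the default [set0] is never taken when
   [labP F] contains the given diagonals. *)
pose fc F i := xget set0 [set G | K i G /\ lab i G = res F i].
have fcP F : faces_containing KP labP (range d) F ->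
    forall i, K i (fc F i) /\ lab i (fc F i) = res F i.
  move=> cF i; have [_ [_ _ surj_i] _] := K_complex i.
  have [G KG GE] := surj_i _ (res_conv F cF i).
  exact: (@xgetPex _ set0 [set G | K i G /\ lab i G = res F i]) (ex_intro _ G (conj KG GE)).
have fc_le F G : faces_containing KP labP (range d) F ->
    faces_containing KP labP (range d) G ->
    (F `<=` G <-> forall i, fc F i `<=` fc G i).
  move=> cF cG; rewrite labP_le; [|exact: cF.1|exact: cG.1].
  split=> [GF i|FG].
    have [KFi lFi] := fcP F cF i; have [KGi lGi] := fcP G cG i.
    by apply/lab_le => //; rewrite lFi lGi; exact: setSI.
  (* With [labP G] written as a glued family, inclusion in [labP F] can be checked on each piece. *)
  rewrite -(glue_restrict p_simple d_noncrossing d_divides _ (labP_conv G cG.1).1 cG.2).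
  move=> e [/cF.2//|[i _ ie]].
  have [KFi lFi] := fcP F cF i; have [KGi lGi] := fcP G cG i.
  have /lab_le := FG i; rewrite lFi lGi => /(_ KFi KGi).
  by move=> /(_ _ ie)[].
pose f F := [set x : forall i, 'rV[R]_(N i) | forall i, fc F i (x i)].
have f_le F G : faces_containing KP labP (range d) F ->
    faces_containing KP labP (range d) G -> (F `<=` G <-> f F `<=` f G).
  move=> cF cG; rewrite fc_le// /f box_subset// => i.
  by apply: K0; exact: (fcP F cF i).1.
exists f; split=> //; split.
- move=> F cF; exists (fc F); split=> // i; exact: (fcP F cF i).1.
(* Injectivity follows from reflecting the order. *)
- move=> F G /set_mem cF /set_mem cG FG; apply/seteqP; split.
    by apply/f_le => //; rewrite FG.
  by apply/f_le => //; rewrite FG.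
(* Surjectivity: the face of [KP] labelled by the glued labels of the factors [F i] restricts to
   these labels, and each [lab i] is injective. *)
- move=> X [F [KF ->]].
  have lF i e : lab i (F i) e -> diagonal (Q i) e.
    by have [[+ _] _] := labK i (F i) (KF i); apply.
  have cg : convex_diagonalization p (glue (range d) (fun i => lab i (F i))).
    by apply/(convex_glue d_noncrossing d_divides _ lF) => i; exact: labK.
  have [G KG GE] := labP_surj _ cg.
  have cG : faces_containing KP labP (range d) G.
    by split=> //; rewrite GE; left.
  suff E i : fc G i = F i.
    exists G => //; rewrite /f; apply/seteqP.
    by split=> x /= H i; have := H i; rewrite E.
  have [KGi lGi] := fcP G cG i.
  have [_ [_ inj_i _] _] := K_complex i.
  apply: inj_i; rewrite ?in_setE//.
  by rewrite lGi /res GE (glue_diagonal d_divides).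
Qed.
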